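(* Let $H$ be a graph with no isolated vertices. There exists a constant $c(H)$ such that $ex(n,K_3,H)\leq c(H)\,n$ for all $n$ if and only if $H$ is a subgraph of an extended friendship graph.
   Context: For graphs $T$ and $H$ with no isolated vertices and an integer $n$, $ex(n,T,H)$ denotes the maximum possible number of copies of $T$ in an $H$-free graph on $n$ vertices. The friendship graph $F_k$ ($k\geq 1$) is the graph consisting of $k$ triangles sharing one common vertex (equivalently, a vertex joined to all $2k$ vertices of a matching of size $k$). A graph is an extended friendship graph if its $2$-core (the maximal subgraph of minimum degree at least $2$) is either empty or isomorphic to $F_k$ for some positive integer $k$. *)

(* Defs.v *)
From HB Require Import structures.
From mathcomp Require Import all_boot all_order all_algebra.
From mathcomp Require Import reals.

Set Implicit Arguments.
Unset Strict Implicit.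
Unset Printing Implicit Defensive.

(* A simple graph with vertex set V, given by its set of (unordered) edges. *)
Record graph (V : finType) := Graph {
  edges : {set {set V}};
  edgesP : [forall e in edges, #|e| == 2] }.

HB.instance Definition _ (V : finType) := [isSub for @edges V].
HB.instance Definition _ (V : finType) := [Finite of graph V by <:].

(* Subgraphs need be neither induced nor spanning. *)
Definition is_subgraph (V : finType) (G : graph V)
    (K : {set V} * {set {set V}}) : bool :=
  (K.2 \subset edges G) && [forall e in K.2, e \subset K.1].

Record subgraph (V : finType) (G : graph V) := Subgraph {
  sub_pair : {set V} * {set {set V}};
  sub_pairP : is_subgraph G sub_pair }.

HB.instance Definition _ (V : finType) (G : graph V) :=
  [isSub for @sub_pair V G].
HB.instance Definition _ (V : finType) (G : graph V) :=
  [Finite of subgraph G by <:].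

Definition sverts (V : finType) (G : graph V) (K : subgraph G) : {set V} :=
  (sub_pair K).1.
Definition sedges (V : finType) (G : graph V) (K : subgraph G) :
  {set {set V}} := (sub_pair K).2.

Definition sub_incl (V : finType) (G : graph V) (K L : subgraph G) : bool :=
  (sverts K \subset sverts L) && (sedges K \subset sedges L).

(* K is isomorphic to T: f is a bijection from the vertices of T onto those   *)
(* of K which maps the edge set of T onto that of K.                          *)
Definition is_copy (U V : finType) (T : graph U) (G : graph V)
    (K : subgraph G) : bool :=
  [exists f : {ffun U -> V},
    [&& injectiveb f,
        sverts K == f @: [set: U] &
        sedges K == [set f @: (e : {set U}) | e in edges T]]].

Definition contains (U V : finType) (H : graph U) (G : graph V) : bool :=
  [exists K : subgraph G, is_copy H K].

Definition is_free (U V : finType) (H : graph U) (G : graph V) : bool :=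
  ~~ contains H G.

Definition ncopies (U V : finType) (T : graph U) (G : graph V) : nat :=
  #|[set K : subgraph G | is_copy T K]|.

(* ex(n, T, H); it is 0 when no graph on n vertices is H-free. *)
Definition gen_turan (n : nat) (U V : finType) (T : graph U) (H : graph V) :
    nat :=
  \max_(G : graph 'I_n | is_free H G) ncopies T G.

Definition no_isolated (V : finType) (G : graph V) : Prop :=
  forall v : V, exists2 e, e \in edges G & v \in e.

(* The graph joining distinct x and y whenever r x y or r y x. *)
Definition rel_edges (V : finType) (r : rel V) : {set {set V}} :=
  [set e | [exists x, exists y, [&& x != y, r x y & e == [set x; y]]]].

Lemma rel_edgesP (V : finType) (r : rel V) :
  [forall e in rel_edges r, #|e| == 2].
Proof.
apply/forall_inP => e; rewrite inE => /existsP[x /existsP[y]].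
by case/and3P=> xy _ /eqP->; rewrite cards2 xy.
Qed.

Definition graph_of_rel (V : finType) (r : rel V) : graph V :=
  Graph (rel_edgesP r).

Definition complete (n : nat) : graph 'I_n := graph_of_rel (fun _ _ => true).

(* None is the common vertex of the k triangles; the other two vertices of    *)
(* the i-th triangle are Some (i, false) and Some (i, true).                  *)
Definition friendship_rel (k : nat) (x y : option ('I_k * bool)) : bool :=
  match x, y with
  | None, Some _ => true
  | Some p, Some q => p.1 == q.1
  | _, None => false
  end.

Definition friendship (k : nat) : graph (option ('I_k * bool)%type) :=
  graph_of_rel (@friendship_rel k).

Definition sdegree (V : finType) (G : graph V) (K : subgraph G) (v : V) : nat :=
  #|[set e in sedges K | v \in e]|.

(* The subgraph without vertices satisfies this for every d. *)
Definition min_degree_ge (V : finType) (G : graph V) (d : nat)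
    (K : subgraph G) : bool :=
  [forall v in sverts K, d <= sdegree K v].

Definition is_two_core (V : finType) (G : graph V) (K : subgraph G) : Prop :=
  min_degree_ge 2 K /\
  forall L : subgraph G, min_degree_ge 2 L -> sub_incl K L -> L = K.

Lemma sub_union_proof (V : finType) (G : graph V) (K L : subgraph G) :
  is_subgraph G (sverts K :|: sverts L, sedges K :|: sedges L).
Proof.
have /andP[sK /forall_inP iK] := sub_pairP K.
have /andP[sL /forall_inP iL] := sub_pairP L.
rewrite /is_subgraph /= subUset [sedges K \subset _]sK [sedges L \subset _]sL /=.
apply/forall_inP => e /setUP[/iK|/iL] ee; apply: subset_trans ee _.
  exact: subsetUl.
exact: subsetUr.
Qed.

Definition sub_union (V : finType) (G : graph V) (K L : subgraph G) :
  subgraph G := Subgraph (sub_union_proof K L).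

Lemma min_degree_ge_union (V : finType) (G : graph V) d (K L : subgraph G) :
  min_degree_ge d K -> min_degree_ge d L -> min_degree_ge d (sub_union K L).
Proof.
move=> /forall_inP dK /forall_inP dL; apply/forall_inP => v.
case/setUP=> [/dK|/dL] /leq_trans; apply; apply/subset_leq_card/subsetP=> e.
  by rewrite !inE => /andP[-> ->].
by rewrite !inE => /andP[-> ->]; rewrite orbT.
Qed.

Lemma two_core_unique (V : finType) (G : graph V) (K L : subgraph G) :
  is_two_core K -> is_two_core L -> K = L.
Proof.
move=> [dK mK] [dL mL]; have dU := min_degree_ge_union dK dL.
have KU : sub_union K L = K by apply: mK dU _; apply/andP; split; apply: subsetUl.
have LU : sub_union K L = L by apply: mL dU _; apply/andP; split; apply: subsetUr.
exact: etrans (esym KU) LU.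
Qed.

Lemma two_core_exists (V : finType) (G : graph V) :
  exists K : subgraph G, is_two_core K.
Proof.
have p0 : is_subgraph G (set0, set0).
  by rewrite /is_subgraph sub0set; apply/forall_inP=> e; rewrite inE.
have d0 : min_degree_ge 2 (Subgraph p0).
  by apply/forall_inP => v; rewrite inE.
pose m (K : subgraph G) := #|sverts K| + #|sedges K|.
case: (@arg_maxnP _ (Subgraph p0) (fun K => min_degree_ge 2 K) m d0) => K dK mK.
exists K; split=> // L dL /andP[sW sE]; have := mK L dL; rewrite /m => le.
have eW : sverts K = sverts L.
  apply/eqP; rewrite eqEcard sW /= -(leq_add2r #|sedges L|).
  by rewrite (leq_trans le) // leq_add2l subset_leq_card.
have eE : sedges K = sedges L.
  by apply/eqP; rewrite eqEcard sE /= -(leq_add2l #|sverts L|) -{2}eW.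
apply: val_inj => /=; move: eW eE; rewrite /sverts /sedges.
by case: (sub_pair K) (sub_pair L) => [? ?] [? ?] /= -> ->.
Qed.

Definition extended_friendship (V : finType) (G : graph V) : Prop :=
  exists2 K : subgraph G, is_two_core K &
    sverts K = set0 \/ exists2 k : nat, 0 < k & is_copy (friendship k) K.

(* Main.v *)
(* Sufficiency.  Let G0 be an extended friendship graph with 2-core F_k.  If  *)
(* G has more than C n triangles, C large, a minimal vertex set Y spanning    *)
(* more than C |Y| of them has every vertex in more than C triangles inside   *)
(* Y, hence minimum degree at least |G0|.  If the link of no vertex of Y had  *)
(* a matching of size k, each link would have a cover of at most 2k vertices  *)
(* and Y would span at most (2k)^2 |Y| triangles.  So Y contains F_k, and the *)
(* trees of G0 hanging from its 2-core are added greedily.                    *)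
(*                                                                            *)
(* Necessity.  There are finite groups generated by d elements of order 3 in  *)
(* which no short reduced word is trivial (let the generators act on reduced  *)
(* words of bounded length).  Their Cayley graphs have no short cycle other   *)
(* than triangles; in the cones over the associated bipartite Cayley graphs,  *)
(* which have large girth, every short cycle passes through the apex.  Both   *)
(* have at least d/3 triangles per vertex.  If ex(n, K_3, H) is linear, H     *)
(* embeds in both, so its cycles are triangles through one common vertex,     *)
(* which forces the 2-core to be empty or F_k.                                *)
Require Import Defs.
From mathcomp Require Import fingroup perm all_boot all_order all_algebra.
From mathcomp Require Import reals zify.

Set Implicit Arguments.
Unset Strict Implicit.
Unset Printing Implicit Defensive.

(** * Embeddings and triangles *)

(** Suppose H lies in an extended friendship graph G0. In a graph with too many triangles, a minimal
    set Y spanning more than C |Y| of them has large minimum degree ([dense_subset],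
    [triangles_at_le]). If all links inside Y had small vertex covers, Y would span few triangles
    ([triangles_in_le]); so some link has a large matching ([matching_or_cover]), which together
    with its centre is a friendship graph ([friendship_in_dense]). Outside its 2-core, G0 is
    dismantled by deleting vertices with at most one remaining neighbour ([two_core_strip]);
    reversing the deletions extends the embedding of the core ([greedy_embedding]).

    Conversely, a linear bound forces H into every graph with enough triangles per vertex
    ([contains_of_many_triangles]). In one such graph all short cycles have at most 3 vertices
    ([many_triangles_no_long_cycle]); in another all short cycles with at least 3 vertices share a
    vertex ([many_triangles_common_vertex]). Both are built from permutation groups in which short
    nonempty reduced words are nontrivial ([girth_generators]). Hence the cycles of H are triangles
    through one vertex v, and in a nonempty 2-core every vertex other than v is adjacent to v and to
    exactly one more vertex ([two_core_friendship]). So H is itself an extended friendship graph. *)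

Definition adj (V : finType) (G : graph V) : rel V :=
  fun x y => [set x; y] \in edges G.

Lemma adjC (V : finType) (G : graph V) : symmetric (adj G).
Proof. by move=> x y; rewrite /adj setUC. Qed.

Lemma adj_neq (V : finType) (G : graph V) x y : adj G x y -> x != y.
Proof. by move/(forall_inP (edgesP G)); rewrite cards2; case: (x != y). Qed.

Lemma edge_adj (V : finType) (G : graph V) e :
  e \in edges G -> exists x y, e = [set x; y] /\ adj G x y.
Proof.
move=> eG; have /cards2P[x [y [_ exy]]] := forall_inP (edgesP G) e eG.
by exists x, y; rewrite /adj -exy.
Qed.

Lemma adj_graph_of_rel (V : finType) (r : rel V) x y :
  adj (graph_of_rel r) x y = (x != y) && (r x y || r y x).
Proof.
rewrite /adj inE; apply/existsP/andP => [[a /existsP[b /and3P[ab rab /eqP E]]]|[xy]].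
  have xy : x != y.
    by have := cards2 x y; rewrite E cards2 ab; case: (x != y).
  have: (x \in [set a; b]) && (y \in [set a; b]) by rewrite -E !inE !eqxx orbT.
  rewrite !inE xy => /andP[/orP[]/eqP ex /orP[]/eqP ey]; move: xy rab;
  by rewrite ex ey ?eqxx // => _ ->; rewrite ?orbT.
case/orP=> [rxy|ryx]; [exists x|exists y]; apply/existsP.
  by exists y; rewrite xy rxy eqxx.
by exists x; rewrite eq_sym xy ryx setUC eqxx.
Qed.

Lemma imset2pt (U V : finType) (f : U -> V) (x y : U) :
  f @: [set x; y] = [set f x; f y].
Proof. by rewrite imsetU1 imset_set1. Qed.

(** Since copies need not be induced, containment amounts to an injective homomorphism. *)
Lemma containsP (U V : finType) (H : graph U) (G : graph V) :
  reflect (exists2 f : U -> V, injective f &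
             forall x y, adj H x y -> adj G (f x) (f y))
          (contains H G).
Proof.
apply: (iffP existsP) => [[K /existsP[f /and3P[/injectiveP injf _ /eqP eK]]]|].
  exists f => // x y xy; have /andP[/subsetP sK _] := sub_pairP K.
  by apply: sK; rewrite -[_.2]/(sedges K) eK -imset2pt imset_f.
move=> [f injf fE].
have sK : is_subgraph G (f @: [set: U], [set f @: (e : {set U}) | e in edges H]).
  apply/andP; split => /=.
    apply/subsetP => _ /imsetP[e /edge_adj[x [y [-> xy]]] ->].
    by rewrite imset2pt; apply: fE.
  by apply/forall_inP => _ /imsetP[e _ ->]; apply/imsetS/subsetT.
exists (Subgraph sK); apply/existsP; exists [ffun x => f x].
have fE' : [ffun x => f x] =1 f by move=> x; rewrite ffunE.
apply/and3P; split.
- by apply/injectiveP => x y; rewrite !ffunE; apply: injf.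
- by apply/eqP/esym/eq_imset.
- by apply/eqP/esym/eq_imset => e; apply: eq_imset.
Qed.

Lemma contains_trans (T U V : finType) (F : graph T) (G : graph U) (H : graph V) :
  contains F G -> contains G H -> contains F H.
Proof.
move=> /containsP[f injf fE] /containsP[g injg gE]; apply/containsP.
by exists (g \o f) => [|x y /fE/gE//]; apply: inj_comp.
Qed.

Definition triangles (V : finType) (G : graph V) : {set {set V}} :=
  [set t : {set V} | (#|t| == 3) &&
     [forall x in t, forall y in t, (x != y) ==> adj G x y]].

Lemma cards3P (V : finType) (A : {set V}) : #|A| = 3 ->
  exists x y z, [/\ x != y, y != z, z != x & A = [set x; y; z]].
Proof.
move=> A3; have := enum_uniq A; have := mem_enum A; rewrite cardE in A3.
case: (enum A) A3 => [|x [|y [|z []]]] //= _ mA.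
rewrite !inE negb_or andbT => /andP[/andP[xy xz] yz].
exists x, y, z; split=> //; first by rewrite eq_sym.
by apply/setP => w; rewrite -mA !inE orbA.
Qed.

Lemma triangleP (V : finType) (G : graph V) (t : {set V}) :
  reflect (exists x y z, [/\ adj G x y, adj G y z, adj G z x & t = [set x; y; z]])
          (t \in triangles G).
Proof.
rewrite inE; apply: (iffP andP) => [[/eqP t3 /forall_inP tE]|].
  have adjt x y : x \in t -> y \in t -> x != y -> adj G x y.
    by move=> xt yt; apply: implyP; apply: (forall_inP (tE x xt)).
  have [x [y [z [xy yz zx e]]]] := cards3P t3.
  by exists x, y, z; split=> //; apply: adjt; rewrite // e !inE eqxx ?orbT.
move=> [x [y [z [xy yz zx ->]]]]; split.
  by rewrite setUC cardsU1 cards2 !inE negb_or (adj_neq zx) [z == y]eq_sym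
    (adj_neq yz) (adj_neq xy).
apply/forall_inP => a; rewrite !inE => /orP[/orP[]|]/eqP->;
  apply/forall_inP => b; rewrite !inE => /orP[/orP[]|]/eqP->; rewrite ?eqxx //=;
  apply/implyP => _ //; rewrite adjC //.
Qed.

Lemma triangle_card (V : finType) (G : graph V) (t : {set V}) :
  t \in triangles G -> #|t| = 3.
Proof. by rewrite inE => /andP[/eqP]. Qed.

Lemma triangle_adj (V : finType) (G : graph V) (t : {set V}) x y :
  t \in triangles G -> x \in t -> y \in t -> x != y -> adj G x y.
Proof.
rewrite inE => /andP[_ /forall_inP tE] xt yt; apply/implyP.
exact: (forall_inP (tE x xt)).
Qed.

Lemma adj_complete n x y : adj (complete n) x y = (x != y).
Proof. by rewrite adj_graph_of_rel andbT. Qed.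

(** A copy of K_3 contains all pairs of its vertices as edges, so it is determined by its vertex
    set. *)
Lemma ncopies_triangles (V : finType) (G : graph V) :
  ncopies (complete 3) G = #|triangles G|.
Proof.
have copyE (K : subgraph G) : is_copy (complete 3) K ->
    sverts K \in triangles G /\
    sedges K = [set e : {set V} | (e \subset sverts K) & #|e| == 2].
  case/existsP => f /and3P[/injectiveP injf /eqP eV /eqP eE].
  have eE2 : sedges K = [set e : {set V} | (e \subset sverts K) & #|e| == 2].
    apply/setP=> e; rewrite inE eE eV; apply/imsetP/andP => [[e' e'E ->]|].
      rewrite imsetS ?subsetT // card_imset //; split=> //.
      exact: (forall_inP (edgesP (complete 3))).
    move=> [/subsetP se /cards2P[x [y [xy exy]]]].
    have /imsetP[i _ ex] : x \in f @: setT by apply: se; rewrite exy !inE eqxx.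
    have /imsetP[j _ ey] : y \in f @: setT by apply: se; rewrite exy !inE eqxx orbT.
    exists [set i; j]; last by rewrite exy ex ey imset2pt.
    rewrite -[_ \in _]/(adj (complete 3) i j) adj_complete.
    by apply: contraNneq xy => ij; rewrite ex ey ij.
  split=> //; rewrite inE eV card_imset // cardsT card_ord eqxx /=.
  apply/forall_inP => x xV; apply/forall_inP => y yV; apply/implyP => xy.
  have /andP[/subsetP sK _] := sub_pairP K; apply: sK.
  by rewrite -[_.2]/(sedges K) eE2 inE cards2 xy eV subUset !sub1set xV yV.
rewrite /ncopies; set C := [set K | _].
have injC : {in C &, injective (@sverts V G)}.
  move=> K L; rewrite !inE => /copyE[_ EK] /copyE[_ EL] EV.
  apply: val_inj; rewrite /= [sub_pair K]surjective_pairing.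
  rewrite [sub_pair L]surjective_pairing -![_.1]/(sverts _) -![_.2]/(sedges _).
  by rewrite EK EL EV.
rewrite -(card_in_imset injC); apply: eq_card => t; apply/imsetP/idP.
  by move=> [K + ->]; rewrite inE => /copyE[].
move=> tG.
have st : is_subgraph G (t, [set e : {set V} | (e \subset t) & #|e| == 2]).
  apply/andP; split; last by apply/forall_inP=> e; rewrite inE => /andP[].
  apply/subsetP => e; rewrite inE => /andP[/subsetP et /cards2P[x [y [xy exy]]]].
  rewrite exy; apply: (triangle_adj tG) => //; apply: et;
  by rewrite exy !inE eqxx ?orbT.
have t3 := triangle_card tG.
have [f injf eV] : exists2 f : {ffun 'I_3 -> V}, injective f & f @: setT = t.
  have injf : injective [ffun i => enum_val (cast_ord (esym t3) i)].
    by move=> i j; rewrite !ffunE => /enum_val_inj/cast_ord_inj.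
  exists [ffun i => enum_val (cast_ord (esym t3) i)] => //.
  apply/eqP; rewrite eqEcard card_imset // cardsT card_ord [leqLHS]t3 leqnn andbT.
  by apply/subsetP => _ /imsetP[i _ ->]; rewrite ffunE enum_valP.
exists (Subgraph st) => //; rewrite inE; apply/existsP.
exists f; apply/and3P; split; [exact/injectiveP | by rewrite eV |].
apply/eqP/setP => e; rewrite inE; apply/andP/imsetP.
  move=> [/subsetP et /cards2P[x [y [xy exy]]]].
  have: x \in t by apply: et; rewrite exy !inE eqxx.
  have: y \in t by apply: et; rewrite exy !inE eqxx orbT.
  rewrite -eV => /imsetP[j _ ey] /imsetP[i _ ex].
  exists [set i; j]; last by rewrite exy ex ey imset2pt.
  rewrite -[_ \in _]/(adj (complete 3) i j) adj_complete.
  by apply: contraNneq xy => ij; rewrite ex ey ij.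
move=> [e' e'E ->]; rewrite card_imset //.
split; first by rewrite -eV imsetS ?subsetT.
exact: (forall_inP (edgesP (complete 3))).
Qed.

Lemma triangles_imset (U V : finType) (G : graph U) (G' : graph V) (f : U -> V) :
  injective f -> (forall x y, adj G x y -> adj G' (f x) (f y)) ->
  #|triangles G| <= #|triangles G'|.
Proof.
move=> injf fE; rewrite -(card_imset _ (imset_inj injf)); apply/subset_leq_card.
apply/subsetP => _ /imsetP[t /triangleP[x [y [z [xy yz zx ->]]]] ->].
apply/triangleP; exists (f x), (f y), (f z); split; try exact: fE.
by rewrite imsetU imset2pt imset_set1.
Qed.

(** [gen_turan] ranges over graphs on ordinals only, so G is transported along the enumeration of
    U. *)
Lemma gen_turan_ge (U V : finType) (G : graph U) (H : graph V) :
  is_free H G -> #|triangles G| <= gen_turan #|U| (complete 3) H.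
Proof.
move=> freeG; pose f : U -> 'I_#|U| := enum_rank.
pose G' : graph 'I_#|U| := graph_of_rel (fun i j => adj G (enum_val i) (enum_val j)).
have G'E i j : adj G' i j = adj G (enum_val i) (enum_val j).
  rewrite adj_graph_of_rel [adj G (enum_val j) _]adjC orbb andb_idl //.
  by move/adj_neq; apply: contraNneq => ->.
have freeG' : is_free H G'.
  apply: contra freeG => HG'; apply: contains_trans HG' _; apply/containsP.
  by exists enum_val => [|i j]; [apply: enum_val_inj | rewrite G'E].
apply: leq_trans (leq_bigmax_cond _ freeG') => /=; rewrite ncopies_triangles.
apply: (@triangles_imset _ _ _ _ enum_rank) => [|x y xy]; first exact: enum_rank_inj.
by rewrite G'E !enum_rankK.
Qed.

(** * The upper bound *)

Lemma triangle_at (V : finType) (G : graph V) (t : {set V}) y :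
  t \in triangles G -> y \in t ->
  exists a b, [/\ adj G y a, adj G y b, adj G a b & t = [set y; a; b]].
Proof.
case/triangleP => p [q [s [pq qs sp ->]]]; rewrite !inE => /orP[/orP[]|]/eqP->.
- by exists q, s; rewrite [adj G p s]adjC.
- by exists p, s; rewrite [adj G q p]adjC [adj G p s]adjC [p |: _]setUC.
- exists p, q; rewrite [adj G s q]adjC; split => //.
  by rewrite [LHS]setUC -setUA.
Qed.

Definition triangles_in (V : finType) (G : graph V) (Y : {set V}) : {set {set V}} :=
  [set t in triangles G | t \subset Y].

(** Take Y of minimum size with more than C |Y| triangles: deleting y destroys this property, so
    more than C triangles pass through y. *)
Lemma dense_subset (V : finType) (G : graph V) C :
  C * #|V| < #|triangles G| ->
  exists2 Y : {set V}, C * #|Y| < #|triangles_in G Y| &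
    forall y, y \in Y -> C < #|[set t in triangles_in G Y | y \in t]|.
Proof.
move=> CG; pose P (Y : {set V}) := C * #|Y| < #|triangles_in G Y|.
have PT : P [set: V].
  rewrite /P cardsT (leq_trans CG) //; apply/subset_leq_card/subsetP => t tG.
  by rewrite inE tG subsetT.
case: (arg_minnP (fun Y : {set V} => #|Y|) PT) => Y PY minY; exists Y => // y yY.
have nP : ~~ P (Y :\ y).
  by apply/negP => /minY; rewrite (cardsD1 y Y) yY ltnn.
rewrite /P -leqNgt in nP; rewrite /P (cardsD1 y Y) yY mulnDr muln1 in PY.
rewrite -(cardsID [set t : {set V} | y \in t] (triangles_in G Y)) in PY.
have E : triangles_in G Y :\: [set t : {set V} | y \in t] = triangles_in G (Y :\ y).
  rewrite /triangles_in; move: (triangles G) => T; apply/setP => t.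
  by rewrite !inE subsetD1 andbC -andbA.
rewrite E in PY.
have -> : [set t in triangles_in G Y | y \in t] = triangles_in G Y :&: [set t : {set V} | y \in t].
  by apply/setP => t; rewrite !inE.
rewrite -(ltn_add2r (C * #|Y :\ y|)); apply: leq_trans PY _.
by rewrite leq_add2l.
Qed.

Lemma triangles_at_le (V : finType) (G : graph V) (Y : {set V}) y :
  #|[set t in triangles_in G Y | y \in t]| <= #|[set z in Y | adj G y z]| ^ 2.
Proof.
set N := [set z in Y | _]; rewrite -mulnn -cardsX.
apply: leq_trans (leq_imset_card (fun p : V * V => [set y; p.1; p.2]) _).
apply/subset_leq_card/subsetP => t; rewrite 2!inE -andbA => /and3P[tG tY yt].
have [a [b [ya yb ab tE]]] := triangle_at tG yt.
apply/imsetP; exists (a, b) => //; rewrite !inE /= ya yb !andbT.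
by apply/andP; split; apply: (subsetP tY); rewrite tE !inE eqxx ?orbT.
Qed.

(** Grow a matching edge by edge; when no edge avoids it, its endpoints form a cover. *)
Lemma matching_or_cover (V : finType) (e : rel V) k : (forall x, ~~ e x x) ->
  (exists m : seq (V * V), [/\ size m = k, uniq (unzip1 m ++ unzip2 m) &
     all (fun p => e p.1 p.2) m]) \/
  (exists2 C : {set V}, #|C| <= 2 * k & forall a b, e a b -> (a \in C) || (b \in C)).
Proof.
move=> irr; elim: k => [|k [[m [sm um em]]|[C sC cC]]]; first by left; exists [::].
  pose C := [set x in unzip1 m ++ unzip2 m].
  have [cov|] := boolP [forall a, forall b, e a b ==> (a \in C) || (b \in C)].
    right; exists C => [|a b]; last by apply/implyP/(forallP (forallP cov a)).
    rewrite cardsE (leq_trans (card_size _)) // size_cat !size_map sm.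
    by rewrite addnn -mul2n leq_mul2l leqnSn orbT.
  rewrite negb_forall => /existsP[a]; rewrite negb_forall => /existsP[b].
  rewrite negb_imply negb_or !inE !mem_cat !negb_or.
  move=> /and3P[ab /andP[a1 a2] /andP[b1 b2]].
  left; exists ((a, b) :: m); split; rewrite /= ?sm ?ab //.
  rewrite mem_cat !inE !negb_or a1 a2 /= andbT cat_uniq /= in um *.
  case/and3P: um => u1 u12 u2; rewrite cat_uniq /= u1 u2 b2 negb_or b1 u12 !andbT.
  by apply: contraTneq ab => ->; apply: irr.
by right; exists C => //; rewrite (leq_trans sC) // leq_mul2l leqnSn orbT.
Qed.

Lemma card_bigcup_leq (I T : finType) (A : {set I}) (F : I -> {set T}) D :
  (forall i, #|F i| <= D) -> #|\bigcup_(i in A) F i| <= #|A| * D.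
Proof.
move=> FD; rewrite -sum_nat_const.
elim/big_rec2: _ => [|i m X _ le]; first by rewrite cards0.
by rewrite (leq_trans (leq_card_setU _ _)) // leq_add.
Qed.

(* Orient every vertex towards its cover: each of the three vertices of a     *)
(* triangle sends an arc inside it, so the triangle contains a directed path  *)
(* a -> b -> c, and such paths are few.                                       *)
Lemma triangles_in_le (V : finType) (G : graph V) (Y : {set V}) D (C : V -> {set V}) :
  (forall y, #|C y| <= D) ->
  (forall y a b, [set y; a; b] \in triangles_in G Y -> adj G y a -> adj G y b ->
     adj G a b -> (a \in C y) || (b \in C y)) ->
  #|triangles_in G Y| <= #|Y| * (D * D).
Proof.
move=> CD cov.
pose F a := \bigcup_(b in C a) \bigcup_(c in C b) [set [set a; b; c]].
have leF a : #|F a| <= D * D.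
  rewrite (leq_trans (@card_bigcup_leq _ _ _ _ D _)) ?leq_mul // => b.
  by rewrite (leq_trans (@card_bigcup_leq _ _ _ _ 1 _)) ?muln1 // => c; rewrite cards1.
apply: leq_trans (card_bigcup_leq Y leF); apply/subset_leq_card/subsetP => t tY.
have path3 a b c : t = [set a; b; c] -> b \in C a -> c \in C b ->
    t \in \bigcup_(i in Y) F i.
  move=> tE ba cb; have aY : a \in Y.
    move: tY; rewrite inE => /andP[_ /subsetP]; apply.
    by rewrite tE !inE eqxx.
  apply/bigcupP; exists a => //; apply/bigcupP; exists b => //.
  by apply/bigcupP; exists c => //; rewrite inE tE.
have arc y : y \in t -> exists a b, t = [set y; a; b] /\ a \in C y.
  move: (tY); rewrite inE => /andP[tG _] /(triangle_at tG)[a [b [ya yb ab tE]]].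
  have := cov y a b; rewrite -tE => /(_ tY ya yb ab) /orP[aC|bC].
    by exists a, b.
  by exists b, a; split=> //; rewrite tE -!setUA [[set a] :|: _]setUC.
have card3 : #|t| = 3 by move: tY; rewrite inE => /andP[/triangle_card].
have inj3 x y z : t = [set x; y; z] -> [/\ x != y, y != z & z != x].
  move=> tE; move: card3; rewrite tE setUC cardsU1 cards2 !inE negb_or.
  by rewrite ![_ == y]eq_sym; case: (z == x) (y == z) (y == x) => [] [] [].
have third x y z x' y' z' : t = [set x; y; z] -> t = [set x'; y'; z'] ->
    x' = x -> y' = y -> z' = z.
  move=> tE tE' ex ey; rewrite ex ey in tE'.
  have [xy yz zx] := inj3 _ _ _ tE; have [_ yz' zx'] := inj3 _ _ _ tE'.
  have : z' \in t by rewrite tE' !inE eqxx orbT.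
  by rewrite tE !inE (negbTE zx') [z' == y]eq_sym (negbTE yz') => /eqP.
have mem3 x y z : t = [set x; y; z] -> [/\ x \in t, y \in t & z \in t].
  by move=> ->; rewrite !inE !eqxx !orbT.
have perm3 x y z x' y' z' : t = [set x; y; z] -> t = [set x'; y'; z'] ->
    x' = x -> (y' = y /\ z' = z) \/ (y' = z /\ z' = y).
  move=> tE tE' ex; have [_ + _] := mem3 _ _ _ tE'; rewrite tE !inE.
  have [xy' _ _] := inj3 _ _ _ tE'; rewrite ex eq_sym in xy'.
  rewrite (negbTE xy') /= => /orP[/eqP ey|/eqP ez]; [left|right]; split=> //.
    exact: third tE tE' ex ey.
  have tE2 : t = [set x; z; y] by rewrite tE -!setUA [[set y] :|: _]setUC.
  exact: third tE2 tE' ex ez.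
have [x xt] : exists x, x \in t by apply/card_gt0P; rewrite card3.
have [y [z [tE yC]]] := arc x xt; have [_ yt zt] := mem3 _ _ _ tE.
have tE2 : t = [set y; x; z] by rewrite tE [x |: _]setUC.
have tE3 : t = [set z; x; y] by rewrite tE [LHS]setUC -setUA.
(* The arc x -> y continues to x -> y -> z unless y points back to x. In that case z points to x or
   to y, giving z -> x -> y or z -> y -> x. *)
have [p [q [E pC]]] := arc y yt.
case: (perm3 _ _ _ _ _ _ tE2 E erefl) => [[ep _]|[ep _]]; subst p; last first.
  exact: path3 tE yC pC.
have [p [q' [E' pC']]] := arc z zt.
case: (perm3 _ _ _ _ _ _ tE3 E' erefl) => [[ep _]|[ep _]]; subst p.
  exact: path3 tE3 pC' yC.
by apply: (path3 z y x _ pC' pC); rewrite tE3 -!setUA [[set x] :|: _]setUC.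
Qed.

Lemma friendship_in_dense (V : finType) (G : graph V) (Y : {set V}) k :
  #|Y| * (2 * k * (2 * k)) < #|triangles_in G Y| ->
  exists2 y, y \in Y & exists m : seq (V * V),
    [/\ size m = k, uniq (unzip1 m ++ unzip2 m) &
     all (fun p => [&& p.1 \in Y, p.2 \in Y, adj G y p.1, adj G y p.2 & adj G p.1 p.2]) m].
Proof.
pose e y a b := [&& a \in Y, b \in Y, adj G y a, adj G y b & adj G a b].
(* Guarding the covering condition by [y \in Y] allows a cover to be chosen for every vertex at
   once; outside Y the empty set serves. *)
pose cover y (C : {set V}) := (#|C| <= 2 * k) &&
  ((y \in Y) ==> [forall a, forall b, e y a b ==> (a \in C) || (b \in C)]).
move=> big.
have [/existsP[y /forallP nC]|] := boolP [exists y, forall C, ~~ cover y C].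
  have yY : y \in Y.
    by apply: contraNT (nC set0) => yY; rewrite /cover cards0 (negbTE yY).
  have irr x : ~~ e y x x by apply/and5P => -[_ _ _ _ /adj_neq]; rewrite eqxx.
  exists y => //; case: (matching_or_cover k irr) => [//|[C sC cC]].
  case/negP: (nC C); rewrite /cover sC yY /=; apply/forallP => a.
  by apply/forallP => b; apply/implyP/cC.
rewrite negb_exists => /forallP hC.
have /fin_all_exists[C CP] y : exists C, cover y C.
  by have := hC y; rewrite negb_forall => /existsP[C]; rewrite negbK; exists C.
have CD y : #|C y| <= 2 * k by have /andP[] := CP y.
have := triangles_in_le CD; move=> /(_ G Y); rewrite leqNgt big => H.
suff: false by []; apply: H => y a b; rewrite inE => /andP[_ /subsetP sY] ya yb ab.
have yY : y \in Y by apply: sY; rewrite !inE eqxx.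
have aY : a \in Y by apply: sY; rewrite !inE eqxx ?orbT.
have bY : b \in Y by apply: sY; rewrite !inE eqxx ?orbT.
have /andP[_] := CP y; rewrite yY => /forallP/(_ a)/forallP/(_ b)/implyP; apply.
by apply/and5P.
Qed.

(** * Extending an embedding of the 2-core to the whole graph *)

(** Remove a vertex v with at most one neighbour in W, embed the rest, and put v back next to the
    image of that neighbour. Fewer than |U| vertices are occupied, so a neighbour inside Y is still
    free. *)
Lemma greedy_embedding (U V : finType) (G0 : graph U) (W0 : {set U})
    (G : graph V) (Y : {set V}) (f0 : U -> V) :
  (forall W : {set U}, W0 \subset W -> W != W0 ->
     exists2 v, v \in W :\: W0 & #|[set u in W | adj G0 v u]| <= 1) ->
  Y != set0 -> (forall y, y \in Y -> #|U| <= #|[set z in Y | adj G y z]|) ->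
  {in W0 &, injective f0} -> {in W0, forall u, f0 u \in Y} ->
  {in W0 &, forall u v, adj G0 u v -> adj G (f0 u) (f0 v)} ->
  contains G0 G.
Proof.
move=> strip Y0 degY inj0 Y0f adj0.
suff H n (W : {set U}) : W0 \subset W -> #|W :\: W0| = n -> exists f : U -> V,
    [/\ {in W &, injective f}, {in W, forall u, f u \in Y} &
        {in W &, forall u v, adj G0 u v -> adj G (f u) (f v)}].
  have [f [injf _ fE]] := H _ [set: U] (subsetT _) erefl.
  by apply/containsP; exists f => [u v|u v]; [apply: injf | apply: fE].
elim: n W => [|n IHn] W sW cW.
  have -> : W = W0.
    apply/eqP; rewrite eqEsubset sW andbT -setD_eq0.
    by rewrite -cards_eq0 cW.
  by exists f0.
have [v vW dv] : exists2 v, v \in W :\: W0 & #|[set u in W | adj G0 v u]| <= 1.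
  by apply: strip => //; apply: contra_eq_neq cW => ->; rewrite setDv cards0.
have /setDP[vinW vW0] := vW.
have [||f [injf fY fE]] := IHn (W :\ v).
- by apply/subsetP => u uW; rewrite !inE (subsetP sW) // andbT;
     apply: contraNneq vW0 => <-.
- apply/eqP; rewrite -eqSS -cW (cardsD1 v (W :\: W0)) vW add1n eqSS; apply/eqP.
  by apply: eq_card => u; rewrite !inE andbCA.
pose I := f @: (W :\ v).
have sI : #|I| < #|U|.
  rewrite (leq_ltn_trans (leq_imset_card _ _)) // -cardsT.
  by apply: proper_card; apply/properP; split; [apply: subsetT | exists v; rewrite ?inE ?eqxx].
have fresh (N : {set V}) : #|U| <= #|N| -> exists2 z, z \in N & z \notin I.
  move=> UN; have : 0 < #|N :\: I|.
    by rewrite cardsD subn_gt0 (leq_ltn_trans (subset_leq_card (subsetIr _ _)))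
       // (leq_trans sI).
  by case/card_gt0P => z /setDP[zN zI]; exists z.
have [z [zY zI zN]] : exists z, [/\ z \in Y, z \notin I &
    forall u, u \in W -> adj G0 v u -> adj G z (f u)].
  have [/set0Pn[u]|] := boolP ([set u in W | adj G0 v u] != set0).
    rewrite inE => /andP[uW vu].
    have uv : u \in W :\ v by rewrite !inE uW eq_sym (adj_neq vu).
    have [z] := fresh _ (degY _ (fY u uv)); rewrite inE => /andP[zY uz] zI.
    exists z; split=> // w wW vw; have [->|wu] := eqVneq w u; first by rewrite adjC.
    have: #|[set u; w]| <= 1.
      apply: leq_trans dv; apply/subset_leq_card/subsetP => x.
      by rewrite !inE => /orP[]/eqP->; rewrite ?uW ?wW.
    by rewrite cards2 eq_sym wu.
  rewrite negbK => /eqP e0; have /set0Pn[y yY] := Y0.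
  have [z zY zI] : exists2 z, z \in Y & z \notin I.
    apply: fresh; apply: leq_trans (degY y yY) (subset_leq_card _).
    by apply/subsetP => z; rewrite inE => /andP[].
  exists z; split=> // u uW vu; have : u \in [set u in W | adj G0 v u] by rewrite inE uW.
  by rewrite e0 inE.
have fI u : u \in W -> u != v -> f u \in I by move=> uW uv; rewrite imset_f // !inE uv.
exists (fun u => if u == v then z else f u); split.
- move=> u w uW wW; have [->|uv] := eqVneq u v; have [->|wv] := eqVneq w v => //.
  + by move=> E; move: (fI _ wW wv); rewrite -E (negbTE zI).
  + by move=> E; move: (fI _ uW uv); rewrite E (negbTE zI).
  by apply: injf; rewrite !inE ?uv ?wv.
- by move=> u uW; have [//|uv] := eqVneq u v; apply: fY; rewrite !inE uv.
move=> u w uW wW; have [->|uv] := eqVneq u v; have [->|wv] := eqVneq w v => uw.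
- by have := adj_neq uw; rewrite eqxx.
- exact: zN.
- by rewrite adjC; apply: zN; rewrite // adjC.
by apply: fE; rewrite // !inE ?uv ?wv.
Qed.

(** The subgraph induced on W has minimum degree at least 2 and includes K, so maximality of K makes
    them equal. Taking W to be the vertex set of K shows that the 2-core is induced. *)
Lemma two_core_induced (V : finType) (G : graph V) (K : subgraph G) (W : {set V}) :
  is_two_core K -> sverts K \subset W ->
  {in W :\: sverts K, forall v, 1 < #|[set u in W | adj G v u]|} ->
  W = sverts K /\ sedges K = [set e in edges G | e \subset W].
Proof.
move=> [/forall_inP dK mK] sKW dW; have /andP[/subsetP sK /forall_inP iK] := sub_pairP K.
have pL : is_subgraph G (W, [set e in edges G | e \subset W]).
  apply/andP; split; first by apply/subsetP => e; rewrite inE => /andP[].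
  by apply/forall_inP => e; rewrite inE => /andP[].
have KL : sub_incl K (Subgraph pL).
  apply/andP; split => //; apply/subsetP => e eK; rewrite inE sK //=.
  exact: subset_trans (iK _ eK) sKW.
suff dL : min_degree_ge 2 (Subgraph pL) by rewrite -(mK _ dL KL).
apply/forall_inP => v vW; have [vK|vK] := boolP (v \in sverts K).
  apply: leq_trans (dK v vK) (subset_leq_card _); apply/subsetP => e.
  by rewrite !inE => /andP[eK ->]; rewrite andbT; have /andP[_ /subsetP/(_ e eK)] := KL; rewrite inE.
apply: leq_trans (dW v _) _; first by rewrite inE vK.
rewrite -(card_in_imset (f := fun u => [set v; u])).
  apply/subset_leq_card/subsetP => _ /imsetP[u + ->]; rewrite !inE => /andP[uW vu].
  by rewrite eqxx [_ \in edges G]vu subUset !sub1set uW [v \in W]vW.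
move=> a b; rewrite !inE => /andP[_ va] /andP[_ vb] E.
have: a \in [set v; b] by rewrite -E !inE eqxx orbT.
by rewrite !inE [a == v]eq_sym (negbTE (adj_neq va)) => /eqP.
Qed.

Lemma two_core_strip (V : finType) (G : graph V) (K : subgraph G) (W : {set V}) :
  is_two_core K -> sverts K \subset W -> W != sverts K ->
  exists2 v, v \in W :\: sverts K & #|[set u in W | adj G v u]| <= 1.
Proof.
move=> cK sKW W_K; apply/exists_inP; apply: contraNT W_K.
rewrite negb_exists_in => /forall_inP H; apply/eqP.
by apply: (two_core_induced cK sKW _).1 => v vW; rewrite ltnNge H.
Qed.

Lemma two_core_adj (V : finType) (G : graph V) (K : subgraph G) u v :
  is_two_core K -> u \in sverts K -> v \in sverts K -> adj G u v ->
  [set u; v] \in sedges K.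
Proof.
move=> cK uK vK uv; rewrite (two_core_induced cK (subxx _) _).2.
  by rewrite inE [_ \in edges G]uv subUset !sub1set uK.
by move=> w; rewrite setDv inE.
Qed.

(** The first lower bound on C gives minimum degree at least |U| inside Y, because a vertex with d
    neighbours in Y lies in at most d^2 triangles of Y. The second gives F_k inside Y, because k <=
    |U|. *)
Lemma extended_friendship_contained (U V : finType) (G0 : graph U) (G : graph V) C :
  extended_friendship G0 -> #|U| ^ 2 <= C -> 2 * #|U| * (2 * #|U|) <= C ->
  C * #|V| < #|triangles G| -> contains G0 G.
Proof.
move=> [K cK hK] CU Ck /dense_subset[Y bigY degY].
have Yn0 : Y != set0.
  apply: contraTneq bigY => ->; rewrite -leqNgt cards0 muln0 leqn0 cards_eq0.
  apply/eqP/setP => t; rewrite !inE subset0; apply/negP => /andP[/andP[/eqP t3 _] /eqP t0].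
  by rewrite t0 cards0 in t3.
have degY' y : y \in Y -> #|U| <= #|[set z in Y | adj G y z]|.
  move=> /degY lt; rewrite -leq_sqr (leq_trans CU) // (leq_trans (ltnW lt)) //.
  exact: triangles_at_le.
have strip := fun W => @two_core_strip U G0 K W cK.
case: hK => [K0|[k k0 /existsP[g /and3P[/injectiveP injg /eqP eV /eqP eE]]]].
  have /set0Pn[y yY] := Yn0.
  by apply: (greedy_embedding (f0 := fun=> y) strip Yn0 degY');
     move=> u; rewrite K0 inE.
have kU : k <= #|U|.
  have := leq_card g injg; rewrite card_option card_prod card_ord card_bool.
  by apply: leq_trans; rewrite muln2 -addnn ltnW // ltnS leq_addr.
have [|y yY [m [sm um em]]] := @friendship_in_dense V G Y k.
  rewrite (leq_ltn_trans _ bigY) // mulnC leq_mul2r (leq_trans _ Ck) ?orbT //.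
  by rewrite leq_mul // leq_mul2l kU orbT.
have m_nth (i : 'I_k) : nth (y, y) m i \in m by rewrite mem_nth ?sm.
have mP (i : 'I_k) := allP em _ (m_nth i).
pose pt (p : 'I_k * bool) := let q := nth (y, y) m p.1 in if p.2 then q.2 else q.1.
have ptE p : pt p = nth y (unzip1 m ++ unzip2 m) (if p.2 then k + p.1 else p.1).
  case: p => i [] /=; rewrite /pt nth_cat size_map sm /=.
    by rewrite ltnNge leq_addr /= addKn (nth_map (y, y)) ?sm.
  by rewrite ltn_ord (nth_map (y, y)) ?sm.
have ptY p : pt p \in Y by case: p => i b; rewrite /pt; case/and5P: (mP i); case: b.
have pt_inj : injective pt.
  move=> [i b] [j c]; rewrite !ptE => /eqP; rewrite nth_uniq //= ?size_cat ?size_map ?sm.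
  - case: b c => [] [] /= /eqP E.
    + by move/addnI: E => /ord_inj->.
    + by have := ltn_ord j; rewrite -E ltnNge leq_addr.
    + by have := ltn_ord i; rewrite E ltnNge leq_addr.
    + by move/ord_inj: E => ->.
  - by case: b; rewrite ?ltn_add2l // ltn_addr.
  - by case: c; rewrite ?ltn_add2l // ltn_addr.
have pt_y p : adj G y (pt p) by case: p => i b; rewrite /pt; case/and5P: (mP i); case: b.
pose F o := if o is Some p then pt p else y.
have F_adj o o' : adj (friendship k) o o' -> adj G (F o) (F o').
  rewrite adj_graph_of_rel => /andP[].
  case: o o' => [[i b]|] [[j c]|] //=; last by rewrite adjC.
  rewrite [j == i]eq_sym orbb => ne /eqP E; subst j.
  have bc : b != c by apply: contraNneq ne => ->.
  by rewrite /pt /=; case/and5P: (mP i) => _ _ _ _; case: b c bc {ne} => [] []; rewrite // adjC.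
have F_inj : injective F.
  move=> [p|] [q|] //=; first by move/pt_inj->.
    by move=> E; have := adj_neq (pt_y p); rewrite E eqxx.
  by move=> E; have := adj_neq (pt_y q); rewrite E eqxx.
(* A left inverse of g; its default value off the image is irrelevant, since only core vertices are
   pulled back for injectivity and adjacency. *)
pose g' u := odflt None [pick o | g o == u].
have gK : cancel g g'.
  move=> o; rewrite /g'; case: pickP => [o' /eqP/injg //|/(_ o)]; by rewrite eqxx.
apply: (greedy_embedding (f0 := F \o g') strip Yn0 degY').
- move=> u v; rewrite eV => /imsetP[o _ ->] /imsetP[o' _ ->] /=.
  by rewrite !gK => /F_inj->.
- by move=> u _ /=; case: (g' u) => [p|] //=.
move=> u v uK vK uv /=; have := two_core_adj cK uK vK uv.
move: uK vK; rewrite eV => /imsetP[o _ ->] /imsetP[o' _ ->].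
rewrite !gK eE => /imsetP[e eF]; rewrite -imset2pt => /(imset_inj injg) E.
by apply: F_adj; rewrite /adj E.
Qed.

Lemma gen_turan_extended_friendship (U V : finType) (G0 : graph U) (H : graph V) :
  extended_friendship G0 -> contains H G0 ->
  exists C, forall n, gen_turan n (complete 3) H <= C * n.
Proof.
move=> eG0 HG0; exists (2 * #|U| * (2 * #|U|)) => n.
apply/bigmax_leqP => G freeG; rewrite ncopies_triangles leqNgt.
apply: contra freeG => big; apply: contains_trans HG0 _.
apply: extended_friendship_contained eG0 _ (leqnn _) _; last by rewrite card_ord.
by rewrite mulnACA mulnn leq_pmull.
Qed.

(** * Groups without short relations and their Cayley graphs *)

(** The letter (i, false) stands for the i-th generator and (i, true) for its square; reduced words
    are the normal forms in a free product of cyclic groups of order 3. *)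
Definition reduced (I : eqType) : pred (seq (I * bool)) :=
  sorted (fun s t => s.1 != t.1).

Lemma reduced_cons (I : eqType) (s t : I * bool) w :
  reduced [:: s, t & w] = (s.1 != t.1) && reduced (t :: w).
Proof. by []. Qed.

Lemma reduced_behead (I : eqType) (s : I * bool) w : reduced (s :: w) -> reduced w.
Proof. by case: w => [|t w] // /andP[]. Qed.

Lemma reduced_head (I : eqType) (i : I) b c w : reduced ((i, b) :: w) -> reduced ((i, c) :: w).
Proof. by case: w. Qed.

Definition syllable (gT : finGroupType) (I : Type) (a : I -> gT) (s : I * bool) : gT :=
  (a s.1 ^+ (if s.2 then 2 else 1)%N)%g.

(* Words are stored with their last syllable first. *)
Fixpoint eval_word (gT : finGroupType) (I : Type) (a : I -> gT)
    (w : seq (I * bool)) : gT :=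
  if w is s :: w' then (eval_word a w' * syllable a s)%g else 1%g.

(* The action of the i-th generator of a free product of cyclic groups of     *)
(* order 3 on the reduced words of length at most r.                          *)
Definition turn (I : eqType) (r : nat) (i : I) (w : seq (I * bool)) :
    seq (I * bool) :=
  let grow := if size w < r then (i, false) :: w else w in
  if w is (j, e) :: w' then
    if j == i then (if e then w' else (i, true) :: w') else grow
  else grow.

Lemma turn_grow (I : eqType) r (i : I) b w : reduced ((i, b) :: w) ->
  size w < r -> turn r i w = (i, false) :: w.
Proof.
case: w => [|[j e] w] /=; first by move=> _ ->.
by case/andP=> ij _ ->; rewrite eq_sym (negbTE ij).
Qed.

Lemma turn_reduced (I : eqType) r (i : I) w :
  reduced w && (size w <= r) -> reduced (turn r i w) && (size (turn r i w) <= r).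
Proof.
case: w => [|[j e] w] /andP[rw sw]; rewrite /turn.
  by case: ifP => // _.
case: eqP => [ji|/eqP ji]; last first.
  case: ifP => [lt|_]; last by rewrite rw.
  by rewrite reduced_cons /= eq_sym ji lt -[path _ _ _]/(reduced ((j, e) :: w)) rw.
subst j; case: e rw sw => rw sw; last by rewrite (reduced_head true rw).
by rewrite (reduced_behead rw) (ltnW sw).
Qed.

(** The orbits are the 3-cycles formed by a word w shorter than r and not headed by i, and by w
    preceded by (i, false) or (i, true). Words of length r not headed by i are fixed. *)
Lemma turn3 (I : eqType) r (i : I) w :
  reduced w -> size w <= r -> turn r i (turn r i (turn r i w)) = w.
Proof.
have cyc w' b : reduced ((i, b) :: w') -> size w' < r ->
    turn r i (turn r i (turn r i w')) = w'.
  by move=> rw sw; rewrite (turn_grow rw sw) /= !eqxx /= eqxx.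
have grows w' : turn r i w' = w' -> turn r i (turn r i (turn r i w')) = w'.
  by move=> E; rewrite !E.
case: w => [|[j e] w] rw sw.
  by case: r sw cyc grows => [|r] _ cyc grows; [apply: grows | apply: (cyc _ true)].
have [ji|ji] := eqVneq j i; last first.
  have [lt|le] := boolP (size ((j, e) :: w) < r).
    by apply: (cyc _ true); rewrite // reduced_cons /= eq_sym ji.
  by apply: grows; rewrite /turn (negbTE ji) (negbTE le).
subst j; have E := turn_grow rw sw.
by case: e rw sw => rw sw /=; rewrite !eqxx /= ?E /= ?eqxx //= E.
Qed.

Lemma girth_generators (I : finType) (r : nat) :
  exists (gT : finGroupType) (a : I -> gT),
    (forall i, (a i ^+ 3)%g = 1%g) /\
    forall w, reduced w -> size w <= r -> eval_word a w = 1%g -> w = [::].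
Proof.
pose T := {w : r.-bseq (I * bool) | reduced w}.
have tP (i : I) (w : T) : reduced (turn r i (val (val w))) && (size (turn r i (val (val w))) <= r).
  by apply: turn_reduced; rewrite (valP w) size_bseq.
have mkP w : reduced w && (size w <= r) -> exists u : T, val (val u) = w.
  case/andP => rw sw.
  by exists (Sub (Bseq sw) rw).
have /fin_all_exists[f fE] i : exists f : {ffun T -> T},
    forall w, val (val (f w)) = turn r i (val (val w)).
  have /fin_all_exists[f fE] (w : T) := mkP _ (tP i w).
  by exists [ffun w => f w] => w; rewrite ffunE.
have TP (u v : T) : val (val u) = val (val v) -> u = v.
  by move=> E; do 2!apply: val_inj.
have f3 i w : f i (f i (f i w)) = w.
  by apply: TP; rewrite !fE turn3 ?size_bseq ?(valP w).
have injf i : injective (f i).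
  by apply: (can_inj (g := fun w => f i (f i w))) => w; apply: f3.
pose a i : {perm T} := perm (injf i).
have [e0 e0E] := mkP [::] isT.
exists {perm T}, a; split=> [i|].
  by apply/perm.permP => w; rewrite !expgS expg0 mulg1 !permM !permE f3.
(* Applied to the empty word, the permutation of a short reduced word spells that word, so it is the
   identity only for the empty word. *)
have key w : reduced w -> size w <= r -> val (val (eval_word a w e0)) = w.
  elim: w => [|[i b] w IHw] rw sw; first by rewrite perm1.
  have {}IHw := IHw (reduced_behead rw) (ltnW sw).
  rewrite /= permM /syllable /=; have E := turn_grow rw sw.
  case: b {rw sw} E => E; first by rewrite expgS expg1 permM !permE !fE IHw E /= eqxx.
  by rewrite expg1 permE fE IHw E.
by move=> w rw sw E; rewrite -(key w rw sw) E perm1.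
Qed.

Lemma syllable_mul (gT : finGroupType) (I : Type) (a : I -> gT) i b c :
  (a i ^+ 3)%g = 1%g ->
  (syllable a (i, b) * syllable a (i, c))%g = if b == c then syllable a (i, ~~ b) else 1%g.
Proof.
rewrite /syllable /= => a3; rewrite -expgD.
by case: b c => [] [] //=; rewrite (expgD _ 3 1) a3 mul1g.
Qed.

(** * Cayley graphs: short cycles and number of triangles *)

Definition cayley (gT : finGroupType) (I : finType) (a : I -> gT) : graph gT :=
  graph_of_rel (fun x y => [exists s, y == x * syllable a s]%g).

Lemma adj_cayley (gT : finGroupType) (I : finType) (a : I -> gT) x y :
  (forall i, (a i ^+ 3)%g = 1%g) -> adj (cayley a) x y ->
  exists s, y = (x * syllable a s)%g.
Proof.
move=> a3; rewrite adj_graph_of_rel => /andP[_ /orP[]/existsP[[i b] /eqP->]].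
  by exists (i, b).
exists (i, ~~ b); rewrite -mulgA syllable_mul //.
by case: b; rewrite ?mulg1.
Qed.

Definition coset3 (gT : finGroupType) (x g : gT) : seq gT := [:: x; x * g; x * g ^+ 2]%g.

Lemma coset3_mul (gT : finGroupType) (I : Type) (a : I -> gT) i x b :
  (x * syllable a (i, b))%g \in coset3 x (a i).
Proof. by rewrite /coset3 /syllable; case: b; rewrite /= !inE ?expg1 eqxx ?orbT. Qed.

(* A step in the direction of the last syllable either changes that syllable  *)
(* or returns to an earlier vertex, so the word of a simple path never gets   *)
(* shorter.                                                                   *)
Lemma cayley_path_word (gT : finGroupType) (I : finType) (a : I -> gT) x p :
  (forall i, (a i ^+ 3)%g = 1%g) -> path (adj (cayley a)) x p -> uniq (x :: p) ->
  exists w, [/\ reduced w, size w <= size p, last x p = (x * eval_word a w)%g &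
    match w with
    | [::] => p = [::]
    | s :: w' => (x * eval_word a w')%g \in x :: p /\
                 (w' = [::] -> {subset x :: p <= coset3 x (a s.1)})
    end].
Proof.
move=> a3; elim/last_ind: p => [|p y IHp].
  by exists [::]; split; rewrite //= mulg1.
rewrite rcons_path -rcons_cons rcons_uniq => /andP[xp /(adj_cayley a3)[[j c] yE]].
case/andP => yp up; have {IHp} [w [rw sw lw]] := IHp xp up.
case: w rw sw lw => [|[i b] w] rw sw lw.
  move=> p0; subst p; rewrite /= in yE; exists [:: (j, c)].
  split; rewrite //= ?mul1g //.
  split=> [|_ z]; first by rewrite mulg1 mem_head.
  by rewrite [_ \in _ :: _]inE mem_seq1 => /orP[]/eqP->; rewrite ?mem_head // yE coset3_mul.
move=> [pw cw]; have [ij|ij] := eqVneq i j; last first.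
  exists [:: (j, c), (i, b) & w]; split.
  - by rewrite reduced_cons /= eq_sym ij.
  - by rewrite size_rcons.
  - by rewrite last_rcons yE lw /= !mulgA.
  by split => //; rewrite -lw mem_rcons inE mem_last orbT.
subst j; move: yE; rewrite lw /= -!mulgA syllable_mul //.
case: ifP => _ yE; last by rewrite yE mulg1 pw in yp.
exists ((i, ~~ b) :: w); split.
- exact: reduced_head rw.
- by rewrite size_rcons ltnW.
- by rewrite last_rcons yE.
split; first by rewrite -rcons_cons mem_rcons inE pw orbT.
move=> w0 z; rewrite -rcons_cons mem_rcons inE => /orP[/eqP->|/cw-> //].
by rewrite yE w0 /= mul1g coset3_mul.
Qed.

(** The edge closing the cycle turns the word of the path into a relation. Unless the last two
    syllables cancel, it is a nonempty short reduced word, which is impossible. If they cancel, the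
    remaining word is trivial, hence empty, and the whole cycle lies in one coset of three
    elements. *)
Lemma cayley_no_cycle (gT : finGroupType) (I : finType) (a : I -> gT) r p :
  (forall i, (a i ^+ 3)%g = 1%g) ->
  (forall w, reduced w -> size w <= r -> eval_word a w = 1%g -> w = [::]) ->
  cycle (adj (cayley a)) p -> uniq p -> size p <= r -> size p <= 3.
Proof.
move=> a3 free; case: p => [|x p] //=; rewrite rcons_path => /andP[xp].
case/(adj_cayley a3) => [[j c] xE] up sp; rewrite leqNgt; apply/negP => p3.
have [w [rw sw lw]] := cayley_path_word a3 xp up.
case: w rw sw lw => [|[i b] w] rw sw lw; first by move=> p0; rewrite p0 in p3.
move=> [pw cw].
have {xE} E : (eval_word a ((i, b) :: w) * syllable a (j, c) = 1)%g.
  by apply: (mulgI x); rewrite mulg1 {2}xE lw mulgA.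
have [ij|ij] := eqVneq i j; last first.
  have := free [:: (j, c), (i, b) & w]; rewrite reduced_cons /= eq_sym ij.
  by move=> /(_ rw (leq_ltn_trans sw sp) E).
subst j; move: E; rewrite /= -mulgA syllable_mul //; case: ifP => _ E.
  by have := free ((i, ~~ b) :: w) (reduced_head _ rw) (leq_trans sw (ltnW sp)) E.
rewrite mulg1 in E.
have w0 := free w (reduced_behead rw) (leq_trans (ltnW sw) (ltnW sp)) E.
have := @uniq_leq_size _ (x :: p) _ up (cw w0); rewrite /= => le.
by rewrite ltnNge le in p3.
Qed.

Lemma short_reduced_neq1 (gT : finGroupType) (I : finType) (a : I -> gT) r w :
  (forall w, reduced w -> size w <= r.+2 -> eval_word a w = 1%g -> w = [::]) ->
  reduced w -> 0 < size w <= 2 -> eval_word a w != 1%g.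
Proof.
move=> free rw /andP[w0 w2]; apply: contraTneq w0 => /free ->//.
exact: leq_trans w2 _.
Qed.

Lemma cayley_triangles (gT : finGroupType) (I : finType) (a : I -> gT) r :
  (forall i, (a i ^+ 3)%g = 1%g) ->
  (forall w, reduced w -> size w <= r.+2 -> eval_word a w = 1%g -> w = [::]) ->
  #|I| * #|gT| <= 3 * #|triangles (cayley a)|.
Proof.
move=> a3 free; have ne := short_reduced_neq1 free.
have ne1 i b : syllable a (i, b) != 1%g.
  by have := ne [:: (i, b)] isT isT; rewrite /= mul1g.
have ne2 i j b c : i != j -> (syllable a (i, b) * syllable a (j, c))%g != 1%g.
  move=> ij; have := ne [:: (j, c); (i, b)]; rewrite /= mul1g; apply=> //.
  by rewrite eq_sym ij.
have syl i x : coset3 x (a i) =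
    [:: x; x * syllable a (i, false); x * syllable a (i, true)]%g.
  by rewrite /coset3 /syllable /= expg1.
pose t i x := [set y in coset3 x (a i)].
have edge x y s : y = (x * syllable a s)%g -> adj (cayley a) x y.
  move=> yE; rewrite adj_graph_of_rel; apply/andP; split.
    rewrite yE -{1}[x]mulg1 (inj_eq (mulgI x)) eq_sym.
    by case: s {yE} => i b; apply: ne1.
  by apply/orP; left; apply/existsP; exists s; rewrite yE.
have tT i x : t i x \in triangles (cayley a).
  apply/triangleP; exists x, (x * syllable a (i, false))%g, (x * syllable a (i, true))%g.
  split.
  - exact: edge.
  - apply: (edge _ _ (i, false)); rewrite -mulgA syllable_mul //.
  - by apply: (edge _ _ (i, false)); rewrite -mulgA syllable_mul // mulg1.
  by apply/setP => y; rewrite /t syl !inE orbA.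
have xt i x : x \in t i x by rewrite inE mem_head.
have t3 i x : size (enum (t i x)) = 3 by rewrite -cardE (triangle_card (tT i x)).
(* Each pair (i, x) is sent to the coset of the i-th generator through x and the position of x in
   it. Distinct generators give distinct cosets through x, as words of length 2 are nontrivial. *)
pose h (q : I * gT) : {set gT} * 'I_3 := (t q.1 q.2, inord (index q.2 (enum (t q.1 q.2)))).
have idx i x : index x (enum (t i x)) < 3 by rewrite -(t3 i x) index_mem mem_enum.
have injh : injective h.
  move=> [i x] [j y] [E /(congr1 (@nat_of_ord 3))]; rewrite !inordK //= => Ei.
  have xy : x = y.
    rewrite -(nth_index x (s := enum (t i x)) (x := x)) ?mem_enum // Ei E.
    by rewrite nth_index // mem_enum.
  subst y; congr pair; apply/eqP/negPn/negP => ij.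
  have : (x * syllable a (i, false))%g \in t j x.
    by rewrite -E inE syl !inE eqxx orbT.
  rewrite inE syl !inE -{2}[x]mulg1 !(inj_eq (mulgI x)) (negbTE (ne1 _ _)) /=.
  case/orP => /eqP Eij.
    have := ne2 i j false true ij; rewrite Eij syllable_mul //.
    by rewrite eqxx.
  have := ne2 i j false false ij; rewrite Eij syllable_mul //.
  by rewrite eqxx.
rewrite -card_prod -(card_imset _ injh).
have -> : 3 * #|triangles (cayley a)| = #|setX (triangles (cayley a)) [set: 'I_3]|.
  by rewrite cardsX cardsT card_ord mulnC.
by apply/subset_leq_card/subsetP => _ /imsetP[[i x] _ ->]; rewrite in_setX tT inE.
Qed.

(** * Cones over bipartite Cayley graphs *)

(** The Boolean is the side of the bipartition and [None] the apex. Only first powers of generators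
    lead from side [false] to side [true], which removes the coset triangles of the Cayley graph. *)
Definition bip_cone (gT : finGroupType) (I : finType) (a : I -> gT) :
    graph (option (gT * bool)) :=
  graph_of_rel (fun u v => match u, v with
    | None, Some _ => true
    | Some (x, false), Some (y, true) => [exists i, y == x * a i]%g
    | _, _ => false
    end).

Lemma adj_bip_cone (gT : finGroupType) (I : finType) (a : I -> gT) u v :
  (forall i, (a i ^+ 3)%g = 1%g) -> adj (bip_cone a) (Some u) (Some v) ->
  v.2 = ~~ u.2 /\ exists i, v.1 = (u.1 * syllable a (i, u.2))%g.
Proof.
move=> a3; rewrite adj_graph_of_rel => /andP[_].
case: u v => [x []] [y []] //=; rewrite ?orbF => /existsP[i /eqP->]; split=> //.
  by exists i; rewrite -mulgA /syllable /= -expgS a3 mulg1.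
by exists i; rewrite /syllable expg1.
Qed.

(** Steps alternate between generators and inverses of generators, so two consecutive steps with the
    same generator would cancel and revisit a vertex. Hence the word of a simple path is reduced and
    as long as the path. *)
Lemma bip_path_word (gT : finGroupType) (I : finType) (a : I -> gT) u p :
  (forall i, (a i ^+ 3)%g = 1%g) ->
  path (relpre Some (adj (bip_cone a))) u p -> uniq (u :: p) ->
  exists w, [/\ reduced w, size w = size p, (last u p).1 = (u.1 * eval_word a w)%g &
    if w is s :: w' then
      s.2 = ~~ (last u p).2 /\ ((u.1 * eval_word a w')%g, s.2) \in u :: p
    else true].
Proof.
move=> a3; elim/last_ind: p => [|p v IHp].
  by exists [::]; split; rewrite //= mulg1.
rewrite rcons_path -rcons_cons rcons_uniq => /andP[up /(adj_bip_cone a3)[v2 [j v1]]].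
case/andP => vp Up; have {IHp} [w [rw sw lw]] := IHp up Up.
set b := (last u p).2 in v2 v1 *.
have def_v : v = ((last u p).1 * syllable a (j, b), ~~ b)%g.
  by rewrite [v]surjective_pairing v1 v2.
have lp : ((u.1 * eval_word a w)%g, b) \in rcons (u :: p) v.
  by rewrite -lw -surjective_pairing mem_rcons inE mem_last orbT.
move=> H1; exists ((j, b) :: w); rewrite size_rcons last_rcons v2 negbK /=.
split; rewrite ?sw ?v1 ?lw ?mulgA //.
case: w rw sw lw {lp} H1 => [|[i c] w] rw sw lw //= [cE pw].
rewrite [path _ _ _]rw andbT; apply: contraNneq vp => ji; rewrite def_v lw /=.
have nb : (~~ b == b) = false by case: (b).
by move: pw; rewrite cE ji -!mulgA syllable_mul // nb mulg1.
Qed.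

(** A cycle avoiding the apex would give a relation. It is a reduced word unless the closing step
    cancels the last syllable; then the rest is empty and the cycle is one edge traversed back and
    forth, which [2 < size p] excludes. *)
Lemma bip_cone_cycle (gT : finGroupType) (I : finType) (a : I -> gT) r p :
  (forall i, (a i ^+ 3)%g = 1%g) ->
  (forall w, reduced w -> size w <= r -> eval_word a w = 1%g -> w = [::]) ->
  cycle (adj (bip_cone a)) p -> uniq p -> 2 < size p <= r -> None \in p.
Proof.
move=> a3 free cp up sp; apply/negPn/negP => Np.
have pE : p = map Some (pmap id p).
  elim: p {cp up sp} Np => [|[x|] p IHp] //=; rewrite inE //= => /IHp {1}->.
  by [].
move: cp up sp; rewrite {}pE (map_inj_uniq (@Some_inj _)) size_map.
case: (pmap id p) => [|u q] //=; rewrite -map_rcons path_map rcons_path.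
case/andP=> uq /(adj_bip_cone a3)[u2 [j u1]] Uq sq.
have [w [rw sw lw]] := bip_path_word a3 uq Uq.
case: w rw sw lw => [|[i c] w] rw sw lw; first by rewrite -sw in sq.
move=> [cE pw]; set b := (last u q).2 in u2 u1 cE.
have E : (eval_word a ((i, c) :: w) * syllable a (j, b) = 1)%g.
  by apply: (mulgI u.1); rewrite mulg1 {2}u1 lw mulgA.
have sqr : size q < r by case/andP: sq.
have [ij|ij] := eqVneq i j; last first.
  have := free [:: (j, b), (i, c) & w]; rewrite reduced_cons /= eq_sym ij.
  by move=> /(_ rw); rewrite -sw in sqr; move=> /(_ sqr E).
move: E; rewrite /= (cE : c = ~~ b) ij -mulgA syllable_mul //.
have nb : (~~ b == b) = false by case: (b).
rewrite nb mulg1 => E; have w0 := free w (reduced_behead rw) _ E.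
move: sq; rewrite -sw w0 // ltnW // -/(size ((i, c) :: w)) sw ltnW //.
Qed.

Lemma bip_cone_triangles (gT : finGroupType) (I : finType) (a : I -> gT) r :
  (forall i, (a i ^+ 3)%g = 1%g) ->
  (forall w, reduced w -> size w <= r.+2 -> eval_word a w = 1%g -> w = [::]) ->
  #|I| * #|gT| <= #|triangles (bip_cone a)|.
Proof.
move=> a3 free; have ne := short_reduced_neq1 free.
pose t (q : I * gT) : {set option (gT * bool)} :=
  [set None; Some (q.2, false); Some (q.2 * a q.1, true)%g].
have tT q : t q \in triangles (bip_cone a).
  apply/triangleP; exists None, (Some (q.2, false)), (Some (q.2 * a q.1, true))%g.
  split=> //; rewrite adj_graph_of_rel //=.
  by rewrite orbF; apply/andP; split; [apply/eqP | apply/existsP; exists q.1].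
have injt : injective t.
  move=> [i x] [j y] E.
  have : Some (x, false) \in t (j, y) by rewrite -E !inE eqxx.
  rewrite !inE => /orP[/orP[]|]/eqP // [xy]; subst y.
  have : Some (x * a i, true)%g \in t (j, x) by rewrite -E !inE eqxx orbT.
  rewrite !inE => /orP[/orP[]|]/eqP // [/mulgI aij].
  congr pair; apply/eqP/negPn/negP => ij.
  have := ne [:: (j, true); (i, false)]; rewrite /= eq_sym ij mul1g.
  by rewrite /syllable /= aij expg1 -expgS a3 eqxx => /(_ isT isT).
rewrite -card_prod -(card_imset _ injt).
by apply/subset_leq_card/subsetP => _ /imsetP[q _ ->].
Qed.

Lemma many_triangles_no_long_cycle d r :
  exists (W : finType) (X : graph W), [/\ 0 < #|W|, d * #|W| <= 3 * #|triangles X| &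
    forall p, cycle (adj X) p -> uniq p -> size p <= r -> size p <= 3].
Proof.
have [gT [a [a3 free]]] := girth_generators 'I_d r.+2.
exists gT, (cayley a); split; first by apply/card_gt0P; exists 1%g.
  by have := cayley_triangles a3 free; rewrite card_ord.
move=> p cp up sp; apply: (cayley_no_cycle a3 free cp up).
by rewrite (leq_trans sp) // ltnW.
Qed.

Lemma many_triangles_common_vertex d r :
  exists (W : finType) (X : graph W) (z : W), d * #|W| <= 3 * #|triangles X| /\
    forall p, cycle (adj X) p -> uniq p -> 2 < size p <= r -> z \in p.
Proof.
have [gT [a [a3 free]]] := girth_generators 'I_d r.+2.
exists (option (gT * bool)), (bip_cone a), None; split.
  have := bip_cone_triangles a3 free; rewrite card_ord => le.
  (* The cone has 2 |gT| + 1 <= 3 |gT| vertices, whence the factor 3. *)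
  rewrite (leq_trans _ (leq_mul (leqnn 3) le)) // mulnCA leq_mul2l.
  rewrite card_option card_prod card_bool muln2 -addnn -add1n mulSn mul2n -addnn leq_add2r.
  by apply/orP; right; apply/card_gt0P; exists 1%g.
move=> p cp up /andP[p2 sp]; apply: (bip_cone_cycle a3 free cp up).
by rewrite p2 (leq_trans sp) // ltnW.
Qed.

(** * Graphs whose cycles are triangles through one vertex *)

Definition sadj (V : finType) (G : graph V) (K : subgraph G) : rel V :=
  fun x y => [set x; y] \in sedges K.

Lemma sadjC (V : finType) (G : graph V) (K : subgraph G) : symmetric (sadj K).
Proof. by move=> x y; rewrite /sadj setUC. Qed.

Lemma sadj_adj (V : finType) (G : graph V) (K : subgraph G) : subrel (sadj K) (adj G).
Proof. by move=> x y; have /andP[/subsetP sK _] := sub_pairP K; apply: sK. Qed.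

Lemma sadj_sverts (V : finType) (G : graph V) (K : subgraph G) x y :
  sadj K x y -> x \in sverts K.
Proof.
move=> xy; have /andP[_ /forall_inP iK] := sub_pairP K.
by apply: (subsetP (iK _ xy)); rewrite !inE eqxx.
Qed.

Lemma sadj_avoid (V : finType) (G : graph V) (K : subgraph G) x w :
  min_degree_ge 2 K -> x \in sverts K -> exists2 y, y != w & sadj K x y.
Proof.
move=> /forall_inP dK /dK; rewrite /sdegree (cardsD1 [set x; w]) => d2.
have /card_gt0P[e] : 0 < #|[set e in sedges K | x \in e] :\ [set x; w]|.
  by case: (_ \in _) d2 => // /ltnW.
rewrite !inE => /and3P[exw eK xe].
have /andP[/subsetP/(_ e eK)/edge_adj[p [q [epq _]]] _] := sub_pairP K.
move: xe; rewrite epq !inE => /orP[]/eqP E; subst x; [exists q | exists p].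
- by apply: contraNneq exw => <-; rewrite epq eqxx.
- by rewrite /sadj -epq.
- by apply: contraNneq exw => <-; rewrite epq setUC eqxx.
- by rewrite /sadj setUC -epq.
Qed.

(** The first vertex of the path has a neighbour y other than its successor. If y is v, stop; if y
    is new, prepend it and continue. If y lies further along the path, a cycle of length at least 3
    avoiding v arises, a contradiction. *)
Lemma extend_path_to (V : finType) (G : graph V) (K : subgraph G) v s :
  min_degree_ge 2 K ->
  (forall p, cycle (adj G) p -> uniq p -> 2 < size p -> v \in p) ->
  sorted (sadj K) s -> uniq s -> v \notin s -> 1 < size s ->
  exists q, [/\ sorted (sadj K) (q ++ s), uniq (q ++ s), v \notin q ++ s &
    sadj K v (head v (q ++ s))].
Proof.
move=> dK cycv; have [n] := ubnP (#|V| - size s); elim: n s => // n IHn s.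
case: s => [|l [|m s]] // ltn ps us vs _.
have lK : l \in sverts K by case/andP: ps => /sadj_sverts.
have [y ym ly] := sadj_avoid m dK lK.
have [yv|yv] := eqVneq y v; first by exists [::]; split; rewrite //= sadjC -yv.
have [ys|ys] := boolP (y \in [:: l, m & s]); last first.
  have [||||//|q] := IHn [:: y, l, m & s].
  - have := max_card (mem [:: y, l, m & s]); rewrite (card_uniqP _); last first.
      by rewrite cons_uniq ys.
    by move: ltn; rewrite /=; lia.
  - by rewrite /= sadjC ly.
  - by rewrite cons_uniq ys.
  - by rewrite inE eq_sym negb_or yv.
  by exists (rcons q y); rewrite cat_rcons.
have yl : y != l by rewrite eq_sym (adj_neq (sadj_adj ly)).
rewrite !inE (negbTE ym) (negbTE yl) /= in ys.
case/splitPr: ys ps us vs {ltn} => A B ps us vs.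
have : v \in [:: l, m & rcons A y].
  apply: cycv; last by rewrite /= size_rcons.
    apply: (sub_cycle (@sadj_adj _ _ K)); rewrite /= !rcons_path last_rcons.
    move: ps; rewrite /= cat_path /= [sadj K y l]sadjC ly andbT.
    by case/and4P=> -> -> ->.
  by move: us; rewrite -cat_rcons -!cat_cons cat_uniq => /andP[].
by move: vs; rewrite -cat_rcons -!cat_cons mem_cat negb_or => /andP[/negbTE->].
Qed.

(* Prolonging the path at both ends until it reaches neighbours of v closes a *)
(* cycle of length at least 4 through v.                                      *)
Lemma no_path3 (V : finType) (G : graph V) (K : subgraph G) v x y z :
  min_degree_ge 2 K ->
  (forall p, cycle (adj G) p -> uniq p -> size p <= 3) ->
  (forall p, cycle (adj G) p -> uniq p -> 2 < size p -> v \in p) ->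
  sadj K x y -> sadj K y z -> x != z -> [&& v != x, v != y & v != z] -> False.
Proof.
move=> dK cyc3 cycv xy yz xz /and3P[vx vy vz].
have nxy := adj_neq (sadj_adj xy); have nyz := adj_neq (sadj_adj yz).
have [|||//|q [sq uq vq hq]] := extend_path_to (s := [:: x; y; z]) dK cycv.
- by rewrite /= xy yz.
- by rewrite /= !inE negb_or nxy xz nyz.
- by rewrite !inE !negb_or vx vy.
have [||||q' [sq' uq' vq' hq']] :=
  extend_path_to (s := rev (q ++ [:: x; y; z])) dK cycv.
- by rewrite rev_sorted (eq_sorted (e' := sadj K)) // => a b; apply: sadjC.
- by rewrite rev_uniq.
- by rewrite mem_rev.
- by rewrite size_rev size_cat addnC.
set s := q' ++ _ in sq' uq' vq' hq'.
have lq : sadj K (last v s) v.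
  rewrite /s last_cat; move: hq; rewrite rev_cat.
  by case: (q) => [|a q0] /=; rewrite ?rev_cons -?rcons_cat ?last_rcons sadjC.
have s3 : 2 < size s by rewrite /s size_cat size_rev size_cat /= !addnS.
have := cyc3 (v :: s); rewrite /= vq' uq' => H.
suff : cycle (adj G) (v :: s) by move/H => /(_ isT); rewrite ltnNge s3.
apply: (sub_cycle (@sadj_adj _ _ K)); rewrite /= rcons_path lq andbT.
by case: (s) s3 sq' hq' => //= b s' _ -> ->.
Qed.

Lemma adj_friendship_Some k (p q : 'I_k * bool) :
  adj (friendship k) (Some p) (Some q) = (q == (p.1, ~~ p.2)).
Proof.
rewrite adj_graph_of_rel; case: p q => [i b] [j c] /=; rewrite [j == i]eq_sym orbb.
apply/andP/eqP => [[ne /eqP ij]|[-> ->]].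
  by subst j; congr pair; apply: contraNeq ne; case: b c => [] [].
by split=> //; apply/eqP => -[]; case: b.
Qed.

(** By [no_path3], a core vertex u other than v has at most one neighbour besides v; minimum degree
    2 makes it adjacent to v and to exactly one mate. Mates come in pairs, and each pair spans a
    triangle with v. *)
Lemma two_core_friendship (V : finType) (G : graph V) (K : subgraph G) v :
  (forall p, cycle (adj G) p -> uniq p -> size p <= 3) ->
  (forall p, cycle (adj G) p -> uniq p -> 2 < size p -> v \in p) ->
  min_degree_ge 2 K -> sverts K != set0 ->
  exists2 k, 0 < k & is_copy (friendship k) K.
Proof.
move=> cyc3 cycv dK; pose K' := sverts K :\ v.
have neq x y : sadj K x y -> x != y by move/sadj_adj/adj_neq.
pose is_mate u w := [&& w \in K', sadj K u w, sadj K u v &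
  [forall w', sadj K u w' ==> (w' == v) || (w' == w)]].
have /fin_all_exists[m mP] u : exists w, (u \in K') ==> is_mate u w.
  have [|_] := boolP (u \in K'); last by exists u.
  rewrite !inE => /andP[uv uK]; have [y yv uy] := sadj_avoid v dK uK.
  have only w : sadj K u w -> (w == v) || (w == y).
    move=> uw; rewrite -[_ || _]negbK negb_or; apply/negP => /andP[wv wy].
    by apply: (no_path3 dK cyc3 cycv (x := w) (y := u) (z := y)) => //;
       [rewrite sadjC | rewrite ![v == _]eq_sym wv uv].
  exists y; apply/and4P; split=> //.
  - by rewrite !inE yv; apply: (@sadj_sverts _ _ _ y u); rewrite sadjC.
  - have [y' y'y uy'] := sadj_avoid y dK uK.
    by have := only _ uy'; rewrite (negbTE y'y) orbF => /eqP <-.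
  by apply/forallP => w; apply/implyP/only.
have {mP} mP u : u \in K' -> [/\ m u \in K', sadj K u (m u), sadj K u v &
    forall w, sadj K u w -> w != v -> w = m u].
  move=> uK; have := mP u; rewrite uK => /and4P[-> -> -> /forallP H]; split=> // w uw wv.
  by have := implyP (H w) uw; rewrite (negbTE wv) => /eqP.
have K'v u : u \in K' -> u != v by rewrite !inE => /andP[].
have mm u : u \in K' -> m (m u) = u.
  move=> uK; have [mK um _ _] := mP u uK; have [_ _ _ H] := mP _ mK.
  by rewrite -(H u) ?K'v // sadjC.
(* One representative of each pair of mates, the one of smaller rank; these index the triangles. *)
pose R := [set u in K' | enum_rank u < enum_rank (m u)].
have RK u : u \in R -> u \in K' by rewrite inE => /andP[].
have Rlt u : u \in R -> enum_rank u < enum_rank (m u) by rewrite inE => /andP[].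
have KR u : u \in K' -> u \in R \/ m u \in R.
  have inR w : (w \in R) = (w \in K') && (enum_rank w < enum_rank (m w)) by rewrite inE.
  move=> uK; rewrite !inR; have [mK um _ _] := mP u uK; rewrite [u \in K']uK [m u \in K']mK mm //=.
  case: ltngtP => [||E]; [by left|by right|].
  by have := neq _ _ um; rewrite -(inj_eq enum_rank_inj) -val_eqE /= E eqxx.
move=> /set0Pn[x xK].
have [u uK] : exists u, u \in K'.
  have [E|xv] := eqVneq x v; last by exists x; rewrite !inE xv.
  have [y yv xy] := sadj_avoid v dK xK; exists y; rewrite !inE yv.
  by apply: (@sadj_sverts _ _ _ y x); rewrite sadjC.
have vK : v \in sverts K.
  by have [_ _ uv _] := mP u uK; apply: (@sadj_sverts _ _ _ v u); rewrite sadjC.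
exists #|R|.
  by apply/card_gt0P; case: (KR u uK) => H; [exists u | exists (m u)].
pose g (p : 'I_#|R| * bool) := if p.2 then m (enum_val p.1) else enum_val p.1.
have eR (i : 'I_#|R|) : enum_val i \in R by apply: enum_valP.
have eK (i : 'I_#|R|) : enum_val i \in K' := RK _ (eR i).
have gK p : g p \in K'.
  by rewrite /g; case: ifP => _ //; have [] := mP _ (eK p.1).
have gm p : m (g p) = g (p.1, ~~ p.2) by rewrite /g /=; case: p.2; rewrite //= mm.
have cross (i j : 'I_#|R|) : enum_val i != m (enum_val j).
  apply/eqP => E; have := Rlt _ (eR i); rewrite {2}E mm // E.
  by have := Rlt _ (eR j) => lt /(ltn_trans lt); rewrite ltnn.
have g_inj : injective g.
  move=> [i b] [j c]; rewrite /g /=; case: b c => [] [] //.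
  - by move/(congr1 m); rewrite !mm // => /enum_val_inj->.
  - by move/esym/eqP; rewrite (negbTE (cross _ _)).
  - by move/eqP; rewrite (negbTE (cross _ _)).
  - by move/enum_val_inj->.
pose f o := if o is Some p then g p else v.
have f_inj : injective f.
  move=> [p|] [q|] //=; first by move/g_inj->.
    by move=> E; have := K'v _ (gK p); rewrite E eqxx.
  by move=> E; have := K'v _ (gK q); rewrite -E eqxx.
have f_adj o o' : sadj K (f o) (f o') = adj (friendship #|R|) o o'.
  case: o o' => [p|] [q|]; last 1 first.
  - by apply/idP/idP => [/neq|/adj_neq]; rewrite eqxx.
  - rewrite adj_friendship_Some -(inj_eq g_inj) -gm /=.
    have [_ gp _ H] := mP _ (gK p).
    by apply/idP/eqP => [/H->|->//]; rewrite ?K'v.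
  - by rewrite adj_graph_of_rel /=; have [_ _ -> _] := mP _ (gK p).
  by rewrite adj_graph_of_rel /= sadjC; have [_ _ -> _] := mP _ (gK q).
have f_surj y : y \in sverts K -> exists o, y = f o.
  move=> yK; have [->|yv] := eqVneq y v; first by exists None.
  have yK' : y \in K' by rewrite !inE yv.
  case: (KR y yK') => yR.
    by exists (Some (enum_rank_in yR y, false)); rewrite /= /g /= enum_rankK_in.
  exists (Some (enum_rank_in yR (m y), true)); rewrite /= /g /= enum_rankK_in //.
  by rewrite mm.
apply/existsP; exists [ffun o => f o]; apply/and3P; split.
- by apply/injectiveP => o o'; rewrite !ffunE; apply: f_inj.
- apply/eqP/setP => y; apply/idP/imsetP => [/f_surj[o ->]|[o _ ->]].
    by exists o; rewrite ?ffunE.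
  by rewrite ffunE; case: o => [p|] //=; have := gK p; rewrite !inE => /andP[].
apply/eqP/setP => e; apply/idP/imsetP => [eE|[e' /edge_adj[o [o' [-> oo']]] ->]].
  have /andP[/subsetP/(_ e eE)/edge_adj[a [b [eab _]]] _] := sub_pairP K.
  have ab : sadj K a b by rewrite /sadj -eab.
  have [o ao] := f_surj _ (sadj_sverts ab).
  have [o' bo] : exists o, b = f o by apply: f_surj; rewrite sadjC in ab; apply: sadj_sverts ab.
  exists [set o; o']; last by rewrite imset2pt !ffunE eab ao bo.
  by rewrite -[_ \in _]/(adj (friendship #|R|) o o') -f_adj -ao -bo.
by rewrite imset2pt !ffunE -[_ \in _]/(sadj K (f o) (f o')) f_adj.
Qed.

(** * From a linear bound to the structure of H *)

Lemma contains_of_many_triangles (W V : finType) (X : graph W) (H : graph V) C D :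
  (forall n, gen_turan n (complete 3) H <= C * n) ->
  3 * C < D -> 0 < #|W| -> D * #|W| <= 3 * #|triangles X| -> contains H X.
Proof.
move=> exH CD W0 big; have [//|free] := boolP (contains H X).
have := leq_trans (gen_turan_ge free) (exH _); rewrite leqNgt => /negP[].
rewrite -(ltn_pmul2l (isT : 0 < 3)) (leq_trans _ big) // mulnA ltn_pmul2r //.
Qed.

(** With 3 C + 1 generators both constructions are too rich in triangles to be H-free. Cycles of H
    have at most |V| vertices and map to cycles of the same length, so excluding cycles up to length
    |V| suffices. *)
Lemma extended_friendship_of_linear (V : finType) (H : graph V) C :
  (forall n, gen_turan n (complete 3) H <= C * n) -> extended_friendship H.
Proof.
move=> exH; have [K cK] := two_core_exists H; exists K => //.
have [->|K0] := eqVneq (sverts K) set0; [by left | right].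
have /set0Pn[x0 _] := K0.
have [W [X [W0 big cyc3]]] := many_triangles_no_long_cycle (3 * C).+1 #|V|.
have [W' [X' [z [big' cycz]]]] := many_triangles_common_vertex (3 * C).+1 #|V|.
have /containsP[f injf fE] := contains_of_many_triangles exH (leqnn _) W0 big.
have W'0 : 0 < #|W'| by apply/card_gt0P; exists z.
have /containsP[g injg gE] := contains_of_many_triangles exH (leqnn _) W'0 big'.
have cyc (T : finType) (Y : graph T) (h : V -> T) p : (forall x y, adj H x y -> adj Y (h x) (h y)) ->
    cycle (adj H) p -> cycle (adj Y) (map h p).
  by move=> hE; rewrite cycle_map; apply: sub_cycle => x y /hE.
have szV (p : seq V) : uniq p -> size p <= #|V|.
  by move/card_uniqP => <-; apply: max_card.
(* If the common vertex z is not in the image of g, then H has no cycle of length at least 3 and the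
   default [x0] serves. *)
pose v := odflt x0 [pick x | g x == z].
apply: (two_core_friendship (v := v)) cK.1 K0 => p cp up.
  rewrite -(size_map f); apply: cyc3; rewrite ?size_map ?(map_inj_uniq injf) ?szV //.
  exact: cyc fE cp.
move=> p2; have : z \in map g p.
  by apply: cycz; rewrite ?size_map ?(map_inj_uniq injg) ?p2 ?szV //; apply: cyc gE cp.
case/mapP => y yp zy; rewrite /v; case: pickP => [w /eqP gw|/(_ y)].
  by rewrite (injg w y) // gw.
by rewrite zy eqxx.
Qed.

Import Order.TTheory GRing.Theory Num.Theory.

Local Open Scope ring_scope.

Theorem theorem1p1 (R : realType) (V : finType) (H : graph V)
    (hH : no_isolated H) :
  (exists c : R, forall n : nat,
     (gen_turan n (complete 3) H)%:R <= c * n%:R) <->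
  (exists (U : finType) (G : graph U), extended_friendship G /\ contains H G).
Proof.
split=> [[c exH]|[U [G [eG HG]]]].
  exists V, H; split; last by apply/containsP; exists id.
  (* A natural number above |c| replaces the real constant, which may be negative. *)
  apply: (@extended_friendship_of_linear _ _ (Num.bound `|c|)) => n.
  rewrite -(ler_nat R) natrM (le_trans (exH n)) // ler_wpM2r ?ler0n //.
  by rewrite (le_trans (ler_norm c)) // ltW // archi_boundP.
have [C exH] := gen_turan_extended_friendship eG HG.
by exists C%:R => n; rewrite -natrM ler_nat.
Qed.
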